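(* Let $k\ge1$, $A=\{1,\dots,m\}$, $B=\{1,\dots,\ell\}$, and let $\{(X_n,Y_n);\,n\ge -k+1\}$ be a (time-homogeneous) Markov chain of memory length $k$ on $A\times B$, with an arbitrary initial distribution for $(X_{-k+1}^0,Y_{-k+1}^0)$ and with an all-positive transition matrix. Let $\Delta_n$ be the likelihood ratio statistic $$\Delta_n=2\left\{\max_{Q\in\mathcal Q_\Theta}\log\Big(\prod_{i=1}^nQ(X_i,Y_i\mid X_{i-k}^{i-1},Y_{i-k}^{i-1})\Big)-\max_{Q\in\mathcal Q_\Phi}\log\Big(\prod_{i=1}^nQ(X_i,Y_i\mid X_{i-k}^{i-1},Y_{i-k}^{i-1})\Big)\right\},$$ where $\mathcal Q_\Theta$ is the set of all $k$th order transition matrices on $A\times B$ with all entries positive, and $\mathcal Q_\Phi\subseteq\mathcal Q_\Theta$ is the set of those which can be decomposed as $$Q(a_0,b_0\mid a_{-k}^{-1},b_{-k}^{-1})=Q^x(a_0\mid a_{-k}^{-1},b_{-k}^{-1})\,Q^y(b_0\mid b_{-k}^{-1})$$ for all $a_{-k}^0\in A^{k+1}$, $b_{-k}^0\in B^{k+1}$. Then $$\Delta_n=2n\,\hat I_n^{(k)}(\boldsymbol X\to\boldsymbol Y),$$ where $\hat I_n^{(k)}(\boldsymbol X\to\boldsymbol Y)$ is the plug-in estimator of the directed information rate.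
   Context: Notation: $\log$ is the natural logarithm; $x_i^j=(x_i,\dots,x_j)$; $I(\cdot;\cdot|\cdot)$ is the conditional (Shannon) mutual information of finite-valued random variables. A $k$th order transition matrix on $A\times B$ is a family $Q(a_k,b_k\mid a_0^{k-1},b_0^{k-1})\ge0$, $a_0^k\in A^{k+1}$, $b_0^k\in B^{k+1}$, with $\sum_{a_k,b_k}Q(a_k,b_k\mid a_0^{k-1},b_0^{k-1})=1$ for all $a_0^{k-1},b_0^{k-1}$. In the decomposition, $Q^x(\cdot\mid a_{-k}^{-1},b_{-k}^{-1})$ and $Q^y(\cdot\mid b_{-k}^{-1})$ are (positive) probability mass functions on $A$ and $B$, respectively. The set $\mathcal Q_\Theta$ is parametrized by an open set $\Theta$ of dimension $m^k\ell^k(m\ell-1)$, and $\mathcal Q_\Phi$ by a lower-dimensional open set $\Phi$ embedded in $\Theta$. The set $\mathcal Q_\Phi$ corresponds to the null hypothesis that each $Y_i$ is conditionally independent of $X_{i-k}^i$ given $Y_{i-k}^{i-1}$. Plug-in estimator: from the sample $(X_{-k+1}^n,Y_{-k+1}^n)$ form the empirical distribution on $A^{k+1}\times B^{k+1}$, $$\hat P_{X_{-k}^0Y_{-k}^0,n}(a_0^k,b_0^k)=\frac1n\sum_{i=1}^n\mathbb I_{\{X_{i-k}^i=a_0^k,\;Y_{i-k}^i=b_0^k\}},$$ and set $\hat I_n^{(k)}(\boldsymbol X\to\boldsymbol Y)=I(\hat Y_0;\hat X_{-k}^0\mid\hat Y_{-k}^{-1})$ where $(\hat X_{-k}^0,\hat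 Y_{-k}^0)\sim\hat P_{X_{-k}^0Y_{-k}^0,n}$.
   Formalization: The two maxima in the likelihood ratio statistic are taken as suprema, because over all-positive transition matrices a maximum need not be attained (for example when n=1 and m=l=2); where the maxima exist they equal the suprema. *)

(* Defs.v *)
From HB Require Import structures.
From mathcomp Require Import all_boot all_order all_algebra.
From mathcomp Require Import all_classical all_reals all_analysis.

Set Implicit Arguments.
Unset Strict Implicit.
Unset Printing Implicit Defensive.

Import Order.TTheory GRing.Theory Num.Theory.

Local Open Scope classical_set_scope.
Local Open Scope ring_scope.

(* The paths x_(-k+1), x_(-k+2), ... are indexed by nat with a shift: index t
   stands for time t - k + 1.  For i = j + 1 >= 1 the past x_(i-k)^(i-1) is then
   [block x j k], x_i is [x (j + k)], and x_(i-k)^i is [block x j k.+1]. *)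
Definition block (C : Type) (x : nat -> C) (j r : nat) : r.-tuple C :=
  [tuple x (j + i)%N | i < r].

Section TransitionMatrices.
Variables (R : realType) (k : nat) (A B : finType).

(* [Q a b a0 b0] is Q(a0, b0 | a, b), with the past (a, b) as first arguments. *)
Definition kernel_fun := k.-tuple A -> k.-tuple B -> A -> B -> R.

Definition transition_matrix (Q : kernel_fun) : Prop :=
  (forall a b a0 b0, 0 <= Q a b a0 b0) /\
  (forall a b, \sum_(a0 : A) \sum_(b0 : B) Q a b a0 b0 = 1).

Definition positive_pmf (C : finType) (q : C -> R) : Prop :=
  (forall c, 0 < q c) /\ \sum_(c : C) q c = 1.

Definition Q_Theta : set kernel_fun :=
  [set Q | transition_matrix Q /\ forall a b a0 b0, 0 < Q a b a0 b0].

Definition Q_Phi : set kernel_fun :=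
  [set Q | Q_Theta Q /\
    exists (Qx : k.-tuple A -> k.-tuple B -> A -> R)
           (Qy : k.-tuple B -> B -> R),
      [/\ forall a b, positive_pmf (Qx a b),
          forall b, positive_pmf (Qy b) &
          forall a b a0 b0, Q a b a0 b0 = Qx a b a0 * Qy b b0]].

Definition log_likelihood (x : nat -> A) (y : nat -> B) (n : nat)
    (Q : kernel_fun) : R :=
  ln (\prod_(j < n) Q (block x j k) (block y j k) (x (j + k)%N) (y (j + k)%N)).

(* The positive matrices do not form a closed set, so when some transitions are
   not observed the maxima need not be attained; they are read as suprema.  The
   sets of values are bounded above by 0, and nonempty when A and B are. *)
Definition likelihood_ratio_statistic
    (x : nat -> A) (y : nat -> B) (n : nat) : R :=
  2 * (sup [set log_likelihood x y n Q | Q in Q_Theta] -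
       sup [set log_likelihood x y n Q | Q in Q_Phi]).

End TransitionMatrices.

Section MutualInformation.
Variables (R : realType) (W : finType) (p : W -> R).

Definition law (U : eqType) (f : W -> U) (u : U) : R := \sum_(w | f w == u) p w.

(* I(f; g | h) for random variables f, g, h on the finite probability space
   (W, p), in nats; the convention 0 log 0 = 0 comes from the factor in front
   of the logarithm. *)
Definition cond_mutual_info (U V Z : finType)
    (f : W -> U) (g : W -> V) (h : W -> Z) : R :=
  \sum_(u : U) \sum_(v : V) \sum_(z : Z)
    law (fun w => (f w, g w, h w)) (u, v, z) *
    ln ((law (fun w => (f w, g w, h w)) (u, v, z) * law h z) /
        (law (fun w => (f w, h w)) (u, z) * law (fun w => (g w, h w)) (v, z))).

End MutualInformation.

Section PlugIn.
Variables (R : realType) (k : nat) (A B : finType).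

Definition empirical (x : nat -> A) (y : nat -> B) (n : nat)
    (ab : k.+1.-tuple A * k.+1.-tuple B) : R :=
  n%:R^-1 *
  \sum_(j < n) ((block x j k.+1 == ab.1) && (block y j k.+1 == ab.2))%:R.

Definition plug_in_directed_info (x : nat -> A) (y : nat -> B) (n : nat) : R :=
  cond_mutual_info (empirical x y n)
    (fun ab => tnth ab.2 ord_max)
    (fun ab => ab.1)
    (fun ab => [tuple tnth ab.2 (widen_ord (leqnSn k) i) | i < k]).

End PlugIn.

Section MarkovChain.
Variables (R : realType) (d : measure_display) (T : measurableType d).
Variable P : probability T R.

Definition cond_prob (E F : set T) : R := fine (P (E `&` F)) / fine (P F).

(* [hx] and [hy] prescribe the whole past; only their values at indices
   t < j + k matter.  The law of the first k pairs is unconstrained. *)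
Definition markov_chain (k : nat) (A B : finType)
    (X : nat -> T -> A) (Y : nat -> T -> B) (Q : kernel_fun R k A B) : Prop :=
  [/\ forall t a, measurable [set w | X t w = a],
      forall t b, measurable [set w | Y t w = b] &
      forall (j : nat) (hx : nat -> A) (hy : nat -> B) (a0 : A) (b0 : B),
        let past := [set w | forall t, (t < j + k)%N ->
                                       X t w = hx t /\ Y t w = hy t] in
        P past != 0%E ->
        cond_prob [set w | X (j + k)%N w = a0 /\ Y (j + k)%N w = b0] past =
        Q (block hx j k) (block hy j k) a0 b0].

End MarkovChain.

(* Main.v *)
(* The identity holds path by path. A kernel enters the likelihood only through
   its values at the observed transitions, so by Gibbs' inequality the supremum
   of the log-likelihood over positive conditional laws is reached, in the limit,
   at the conditional empirical frequencies. Over Q_Phi the log-likelihood is a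
   sum of a term in Q^x and a term in Q^y, which are maximised separately. The
   counts N(x-past, y-past) cancel in the difference of the two suprema, and what
   remains,
     sum_i log (N(x-past, y-past, X_i, Y_i) N(y-past)
                / (N(x-past, y-past, X_i) N(y-past, Y_i))),
   is n times the conditional mutual information of the empirical law. *)
Require Import Defs.
From HB Require Import structures.
From mathcomp Require Import all_boot all_order all_algebra.
From mathcomp Require Import all_classical all_reals all_analysis.
From mathcomp Require Import ring lra.
Import Order.TTheory GRing.Theory Num.Theory.
Local Open Scope ring_scope.

(** * Logarithms and suprema *)

Lemma ln_le_subr1 {R : realType} (x : R) : 0 < x -> ln x <= x - 1.
Proof.
move=> x0; have := @le_ln1Dx R (x - 1).
by rewrite (addrC 1) subrK; apply; lra.
Qed.

Lemma ln_prod {R : realType} (D : finType) (f : D -> R) :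
  (forall i, 0 < f i) -> ln (\prod_i f i) = \sum_i ln (f i).
Proof.
(* [K] carries positivity through the induction, since [ln] turns products into sums only on
   positive reals. *)
move=> f0; pose K x (y : R) := 0 < x /\ ln x = y.
suff: K (\prod_i f i) (\sum_i ln (f i)) by case.
apply: (big_rec2 K) => [|i y x _ [x0 <-]]; split; rewrite ?ltr01 ?ln1//.
  exact: mulr_gt0.
by rewrite lnM ?posrE.
Qed.

(** Suited to suprema that need not be attained; the second hypothesis also supplies the
    nonemptiness of [E]. *)
Lemma sup_eq {R : realType} (E : set R) (v : R) :
  (forall x, E x -> x <= v) ->
  (forall eps, 0 < eps -> exists2 x, E x & v - eps <= x) -> sup E = v.
Proof.
move=> ubE approx; have [x0 Ex0 _] := approx _ ltr01.
apply/le_anti/andP; split; first by apply: ge_sup => //; exists x0.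
apply/ler_addgt0Pr => e /approx[x Ex vx].
rewrite -lerBlDr (le_trans vx)//.
by apply: ub_le_sup => //; exists v.
Qed.

(** * Occurrence counts in a finite sample *)

Definition count_eq (R : realType) {D : finType} {U : eqType}
    (f : D -> U) (u : U) : R :=
  \sum_i (f i == u)%:R.

Section Counts.
Context {R : realType} {D : finType}.
Local Notation N := (count_eq R).

Lemma count_eq_ge0 {U : eqType} (f : D -> U) u : 0 <= N f u.
Proof. by apply: sumr_ge0 => i _; rewrite ler0n. Qed.

Lemma count_eq_ge1 {U : eqType} (f : D -> U) i : 1 <= N f (f i).
Proof.
rewrite /count_eq (bigD1 i)//= eqxx lerDl.
by apply: sumr_ge0 => j _; rewrite ler0n.
Qed.

Lemma count_eq_gt0 {U : eqType} (f : D -> U) i : 0 < N f (f i).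
Proof. exact: lt_le_trans ltr01 (count_eq_ge1 f i). Qed.

Lemma count_eq_congr {U V : eqType} (f : D -> U) (g : D -> V) u v :
  (forall i, (f i == u) = (g i == v)) -> N f u = N g v.
Proof. by move=> fg; apply: eq_bigr => i _; rewrite fg. Qed.

(** Passes between sums over an alphabet and sums over the sample: after exchanging the sums, each
    index [i] keeps only the term [u = f i]. *)
Lemma sum_count_eq {U : finType} (f : D -> U) (g : U -> R) :
  \sum_u N f u * g u = \sum_i g (f i).
Proof.
rewrite /count_eq; under eq_bigr do rewrite mulr_suml.
rewrite exchange_big/=; apply: eq_bigr => i _.
rewrite (bigD1 (f i))//= eqxx mul1r big1 ?addr0// => u.
by rewrite eq_sym => /negPf->; rewrite mul0r.
Qed.

Lemma sum_count_eq_pair {S C : finType} (s : D -> S) (c : D -> C) t :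
  \sum_e N (fun i => (s i, c i)) (t, e) = N s t.
Proof.
rewrite /count_eq exchange_big/=; apply: eq_bigr => i _.
under eq_bigr do rewrite xpair_eqE.
rewrite (bigD1 (c i))//= eqxx andbT big1 ?addr0// => e.
by rewrite eq_sym => /negPf->; rewrite andbF.
Qed.

(** * Maximum likelihood for one conditional law *)

Section ConditionalLikelihood.
Context {S C : finType} (s : D -> S) (c : D -> C).

(* The value at the conditional frequencies, which need not be positive off the
   sample and hence need not be an admissible [q] below. *)
Definition max_log_likelihood : R :=
  \sum_i ln (N (fun j => (s j, c j)) (s i, c i) / N s (s i)).

(** Gibbs' inequality, from [ln r <= r - 1] at the ratio [r] of [q] to the conditional frequency. *)
Lemma log_likelihood_le (q : S -> C -> R) :
  (forall t, positive_pmf (q t)) ->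
  \sum_i ln (q (s i) (c i)) <= max_log_likelihood.
Proof.
move=> qP; rewrite -subr_le0 /max_log_likelihood -sumrB.
pose sc j := (s j, c j).
pose g (p : S * C) := q p.1 p.2 * N s p.1 / N sc p - 1.
apply: (@le_trans _ _ (\sum_i g (sc i))).
  apply: ler_sum => i _.
  have q0 : 0 < q (s i) (c i) by have [/(_ (c i))] := qP (s i).
  have n0 := count_eq_gt0 sc i; have m0 := count_eq_gt0 s i.
  rewrite -/(sc i) -ln_div ?posrE ?divr_gt0// invf_div mulrA.
  by apply: ln_le_subr1; rewrite divr_gt0 ?mulr_gt0.
rewrite -(sum_count_eq sc) /g.
(* Terms agree at observed pairs; at an unobserved pair the left one is 0 and the right one is
   nonnegative. *)
apply: (@le_trans _ _ (\sum_p (q p.1 p.2 * N s p.1 - N sc p))).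
  apply: ler_sum => -[t e] _ /=.
  have q0 : 0 < q t e by have [/(_ e)] := qP t.
  have := count_eq_ge0 sc (t, e); rewrite le_eqVlt => /predU1P[<-|n0].
    by rewrite mul0r subr0 mulr_ge0 ?count_eq_ge0// ltW.
  by rewrite mulrBr mulr1 mulrCA divff ?mulr1// gt_eqF.
rewrite sumrB subr_le0.
rewrite -(pair_bigA _ (fun t e => q t e * N s t)).
rewrite -(pair_bigA _ (fun t e => N sc (t, e)))/=.
apply: ler_sum => t _; rewrite -mulr_suml (qP t).2 mul1r.
by rewrite sum_count_eq_pair.
Qed.

(* Adding [del] to every count makes the conditional frequencies positive, and
   lowers each term of the log-likelihood by at most [del * #|C|]. *)
Lemma log_likelihood_approx {eps : R} : inhabited C -> 0 < eps ->
  exists2 q : S -> C -> R, (forall t, positive_pmf (q t)) &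
    max_log_likelihood - eps <= \sum_i ln (q (s i) (c i)).
Proof.
move=> [c0] eps0; pose sc j := (s j, c j).
have C0 : (0 : R) < #|C|%:R by rewrite ltr0n; apply/card_gt0P; exists c0.
(* Chosen so that the total loss [#|D| * del * #|C|] is at most [eps]; the [+ 1] keeps the
   denominator positive for empty [D]. *)
pose del := eps / (#|D|%:R * #|C|%:R + 1).
have D0 : (0 : R) <= #|D|%:R by rewrite ler0n.
have den0 : 0 < #|D|%:R * #|C|%:R + 1 :> R.
  by rewrite ltr_wpDl// mulr_ge0// ltW.
have del0 : 0 < del by rewrite divr_gt0.
have Z0 t : 0 < N s t + del * #|C|%:R.
  by rewrite ltr_wpDl ?count_eq_ge0// mulr_gt0.
have W0 p : 0 < N sc p + del by rewrite ltr_wpDl ?count_eq_ge0.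
exists (fun t e => (N sc (t, e) + del) / (N s t + del * #|C|%:R)).
  move=> t; split=> [e|]; first exact: divr_gt0.
  rewrite -mulr_suml big_split/= sum_count_eq_pair sumr_const -[del *+ _]mulr_natr.
  by rewrite divff// gt_eqF.
rewrite lerBlDl -lerBlDr /max_log_likelihood -sumrB.
apply: (@le_trans _ _ (\sum_(i : D) del * #|C|%:R)); last first.
  rewrite sumr_const -[_ *+ #|D|]mulr_natl mulrCA /del mulrAC ler_pdivrMr//.
  by rewrite ler_pM2l// lerDl.
apply: ler_sum => i _; rewrite -/(sc i).
have n0 := count_eq_gt0 sc i; have m1 := count_eq_ge1 s i.
have m0 := count_eq_gt0 s i.
rewrite -ln_div ?posrE ?divr_gt0// invf_div.
apply: le_trans (ln_le_subr1 _ _) _; first by rewrite mulr_gt0 ?divr_gt0.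
rewrite lerBlDr mulf_div ler_pdivrMr ?mulr_gt0//.
have d0 : 0 <= del * #|C|%:R by rewrite mulr_ge0// ltW.
move: (N sc (sc i)) (N s (s i)) (del * _) n0 m1 m0 d0 del0 => a b r.
set dd := del; clearbody dd => a0 b1 b0 r0 d0.
(* The goal [a * (b + r) <= (r + 1) * (b * (a + dd))] has the sum of the expressions in [h1] and
   [h2] as the difference of its sides. Here [1 <= b] because [s i] occurs at [i] itself. *)
have h1 : 0 <= r * a * (b - 1) by rewrite !mulr_ge0// ?(ltW a0) ?subr_ge0.
have h2 : 0 <= (r + 1) * b * dd.
  by rewrite !mulr_ge0 ?addr_ge0 ?(ltW b0) ?(ltW d0).
nra.
Qed.

End ConditionalLikelihood.

(** * Mutual information of an empirical law *)

Section EmpiricalLaw.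
Context {W : finType} (s : D -> W) (p : W -> R).
Context (pE : forall w, p w = #|D|%:R^-1 * N s w).

Lemma law_count_eq {U : eqType} (f : W -> U) u :
  law p f u = #|D|%:R^-1 * N (f \o s) u.
Proof.
rewrite /law; under eq_bigr do rewrite pE.
rewrite -mulr_sumr; congr (_ * _).
rewrite big_mkcond -[RHS](sum_count_eq s (fun w => (f w == u)%:R)).
by apply: eq_bigr => w _; case: eqP; rewrite ?mulr1 ?mulr0.
Qed.

(** Inside the logarithm the factors [#|D|^-1] cancel, two above and two below; the outer one
    cancels against [#|D|]. The weights left are counts, so [sum_count_eq] applies. *)
Lemma cond_mutual_info_count_eq {U V Z : finType}
    (f : W -> U) (g : W -> V) (h : W -> Z) :
  inhabited D ->
  #|D|%:R * cond_mutual_info p f g h =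
  \sum_i ln (N (fun j => (f (s j), g (s j), h (s j)))
                 (f (s i), g (s i), h (s i)) *
               N (h \o s) (h (s i)) /
              (N (fun j => (f (s j), h (s j))) (f (s i), h (s i)) *
               N (fun j => (g (s j), h (s j))) (g (s i), h (s i)))).
Proof.
move=> [i0]; have D0 : #|D|%:R != 0 :> R.
  by rewrite pnatr_eq0 -lt0n; apply/card_gt0P; exists i0.
pose G (r : U * V * Z) : R :=
  ln (N (fun j => (f (s j), g (s j), h (s j))) r * N (h \o s) r.2 /
     (N (fun j => (f (s j), h (s j))) (r.1.1, r.2) *
      N (fun j => (g (s j), h (s j))) (r.1.2, r.2))).
rewrite -(sum_count_eq (fun j => (f (s j), g (s j), h (s j))) G).
rewrite /cond_mutual_info !pair_bigA mulr_sumr; apply: eq_bigr => -[[u v] z] _ /=.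
rewrite !law_count_eq 2!mulrA divff// mul1r /G/=; congr (_ * ln _).
rewrite mulrACA [in X in _ / X]mulrACA -mulf_div.
by rewrite divff ?mul1r// mulf_neq0 ?invr_eq0.
Qed.
End EmpiricalLaw.
End Counts.

(** * Likelihoods and directed information along a path *)

Section DirectedInformation.
Context {R : realType} {A B : finType}.
Context (k : nat) (x : nat -> A) (y : nat -> B) (n : nat).
Local Notation N := (count_eq R).
Let Xpast (j : 'I_n) := block x j k.
Let Ypast (j : 'I_n) := block y j k.
Let X0 (j : 'I_n) := x (j + k)%N.
Let Y0 (j : 'I_n) := y (j + k)%N.

Lemma sup_Q_Theta :
  sup [set log_likelihood x y n Q | Q in @Q_Theta R k A B]%classic =
  max_log_likelihood (fun j => (Xpast j, Ypast j)) (fun j => (X0 j, Y0 j)).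
Proof.
apply: sup_eq => [_ [Q [[_ Q1] Q0] <-]|eps e0].
  rewrite /log_likelihood ln_prod//.
  apply: (log_likelihood_le (fun j => (Xpast j, Ypast j)) (fun j => (X0 j, Y0 j))
    (fun s c => Q s.1 s.2 c.1 c.2)) => -[a b]; split=> [c|]//=.
  by rewrite -(Q1 a b) pair_bigA.
(* The path itself witnesses that the alphabets are nonempty. *)
have AB : inhabited (A * B)%type by exists; exact: (x 0%N, y 0%N).
have [q qP ql] := log_likelihood_approx (fun j => (Xpast j, Ypast j))
  (fun j => (X0 j, Y0 j)) AB e0.
pose Q : kernel_fun R k A B := fun a b a0 b0 => q (a, b) (a0, b0).
have Q0 a b a0 b0 : 0 < Q a b a0 b0 by exact: (qP (a, b)).1.
exists (log_likelihood x y n Q); last by rewrite /log_likelihood ln_prod.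
exists Q => //; split=> //; split=> [a b a0 b0|a b]; first exact: ltW.
rewrite pair_bigA -(qP (a, b)).2; by apply: eq_bigr => -[].
Qed.

Lemma sup_Q_Phi :
  sup [set log_likelihood x y n Q | Q in @Q_Phi R k A B]%classic =
  max_log_likelihood (fun j => (Xpast j, Ypast j)) X0 +
  max_log_likelihood Ypast Y0.
Proof.
have lnE (Q : kernel_fun R k A B) Qx Qy : (forall a b, positive_pmf (Qx a b)) ->
    (forall b, positive_pmf (Qy b)) ->
    (forall a b a0 b0, Q a b a0 b0 = Qx a b a0 * Qy b b0) ->
    log_likelihood x y n Q =
    \sum_i ln (Qx (Xpast i) (Ypast i) (X0 i)) + \sum_i ln (Qy (Ypast i) (Y0 i)).
  move=> Qx0 Qy0 QE; rewrite /log_likelihood ln_prod => [|i].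
    rewrite -big_split; apply: eq_bigr => i _ /=.
    by rewrite QE lnM ?posrE ?(Qx0 _ _).1 ?(Qy0 _).1.
  by rewrite QE mulr_gt0 ?(Qx0 _ _).1 ?(Qy0 _).1.
apply: sup_eq => [_ [Q [_ [Qx [Qy [Qx0 Qy0 QE]]]] <-]|eps e0].
  rewrite (lnE _ Qx Qy)// lerD//; last exact: log_likelihood_le.
  by apply: (log_likelihood_le (fun j => (Xpast j, Ypast j)) X0
    (fun s => Qx s.1 s.2)) => -[].
(* The two factors vary independently, so each is approximated to within half of [eps]. *)
have e20 : 0 < eps / 2 by rewrite divr_gt0.
have [qx qxP qxl] := log_likelihood_approx (fun j => (Xpast j, Ypast j)) X0
  (inhabits (x 0%N)) e20.
have [qy qyP qyl] := log_likelihood_approx Ypast Y0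
  (inhabits (y 0%N)) e20.
pose Q : kernel_fun R k A B := fun a b a0 b0 => qx (a, b) a0 * qy b b0.
exists (log_likelihood x y n Q); last first.
  rewrite (lnE _ (fun a b => qx (a, b)) qy)//.
  by rewrite [eps]splitr opprD addrACA lerD.
have Q0 a b a0 b0 : 0 < Q a b a0 b0.
  by rewrite mulr_gt0 ?(qxP _).1 ?(qyP _).1.
exists Q => //; split; last by exists (fun a b => qx (a, b)), qy.
split=> //; split=> [a b a0 b0|a b]; first exact: ltW.
rewrite -(qxP (a, b)).2; apply: eq_bigr => a0 _.
by rewrite -mulr_sumr (qyP b).2 mulr1.
Qed.

Lemma empirical_count_eq ab : empirical R x y n ab =
  #|'I_n|%:R^-1 * N (fun j : 'I_n => (block x j k.+1, block y j k.+1)) ab.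
Proof. by rewrite /empirical card_ord. Qed.

(** Splits the windows of length [k.+1] of the empirical law into past and present, the form in
    which the likelihoods count. *)
Lemma block_S (C : eqType) (z : nat -> C) i j :
  (block z i k.+1 == block z j k.+1) =
  (block z i k == block z j k) && (z (i + k)%N == z (j + k)%N).
Proof.
apply/eqP/andP => [E|[/eqP E /eqP F]].
  split; apply/eqP; last first.
    by have := congr1 (fun t => tnth t ord_max) E; rewrite !tnth_mktuple.
  apply: eq_from_tnth => t.
  by have := congr1 (fun u => tnth u (widen_ord (leqnSn k) t)) E; rewrite !tnth_mktuple.
apply: eq_from_tnth => t; rewrite !tnth_mktuple.
have := ltn_ord t; rewrite ltnS leq_eqVlt => /orP[/eqP->//|tk].
by have := congr1 (fun u => tnth u (Ordinal tk)) E; rewrite !tnth_mktuple.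
Qed.

Lemma block_prefix (C : Type) (z : nat -> C) j :
  [tuple tnth (block z j k.+1) (widen_ord (leqnSn k) i) | i < k] = block z j k.
Proof. by apply: eq_from_tnth => t; rewrite !tnth_mktuple. Qed.

Lemma tnth_block_max (C : Type) (z : nat -> C) j :
  tnth (block z j k.+1) ord_max = z (j + k)%N.
Proof. by rewrite tnth_mktuple. Qed.

Lemma plug_in_count_eq : (0 < n)%N ->
  n%:R * plug_in_directed_info R k x y n =
  max_log_likelihood (fun j => (Xpast j, Ypast j)) (fun j => (X0 j, Y0 j)) -
  (max_log_likelihood (fun j => (Xpast j, Ypast j)) X0 +
   max_log_likelihood Ypast Y0).
Proof.
move=> n0; rewrite -[in n%:R](card_ord n).
rewrite (cond_mutual_info_count_eq _ _ empirical_count_eq); last first.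
  by exists; exact: Ordinal n0.
rewrite /max_log_likelihood -big_split -sumrB; apply: eq_bigr => i _ /=.
set J := fun j => (Xpast j, Ypast j, (X0 j, Y0 j)).
set JX := fun j => (Xpast j, Ypast j, X0 j).
set JY := fun j => (Ypast j, Y0 j).
set XY := fun j => (Xpast j, Ypast j).
rewrite -/(J i) -/(JX i) -/(JY i) -/(XY i).
have [J0 JX0] := (count_eq_gt0 (R := R) J i, count_eq_gt0 (R := R) JX i).
have [JY0 XY0] := (count_eq_gt0 (R := R) JY i, count_eq_gt0 (R := R) XY i).
have Ypast0 := count_eq_gt0 (R := R) Ypast i.
(* The common factor [N XY (XY i)] has cancelled. The events counted by the information are the same
   up to regrouping: [Ypast] occurs in the window as the conditioning variable, and [X0] as the last
   letter of the block of [x]. *)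
transitivity (ln (N J (J i) * N Ypast (Ypast i) / (N JY (JY i) * N JX (JX i)))).
  congr (ln (_ * _ / (_ * _))); apply: count_eq_congr => j /=.
  - rewrite !tnth_block_max !block_prefix !xpair_eqE block_S.
    by rewrite -!andbA; do !bool_congr.
  - by rewrite !block_prefix.
  - by rewrite !tnth_block_max !block_prefix !xpair_eqE andbC.
  - by rewrite !block_prefix !xpair_eqE block_S andbAC.
rewrite !ln_div ?posrE ?mulr_gt0// !lnM ?posrE//.
by ring.
Qed.

End DirectedInformation.

Theorem proposition3p5 (R : realType) (d : measure_display)
  (T : measurableType d) (P : probability T R)
  (k m l : nat) (hk : (1 <= k)%N)
  (X : nat -> T -> 'I_m) (Y : nat -> T -> 'I_l)
  (Q : kernel_fun R k 'I_m 'I_l)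
  (hQ : Q_Theta Q) (hXY : markov_chain P X Y Q)
  (n : nat) (hn : (1 <= n)%N) (w : T) :
  likelihood_ratio_statistic R k (fun t => X t w) (fun t => Y t w) n =
  2 * n%:R * plug_in_directed_info R k (fun t => X t w) (fun t => Y t w) n.
Proof.
rewrite /likelihood_ratio_statistic sup_Q_Theta sup_Q_Phi.
by rewrite -plug_in_count_eq// mulrA.
Qed.
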